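(* Let $r_1=r_2=1$ and $r_3=\rho\ge\sqrt2$, and let $P_1,P_2,P_3$ be independent random points with $P_k$ uniform on the circle of radius $r_k$ about $O$. Then $$P(\text{obtuse})=1-\frac{4}{\pi^2}\,\chi_2\!\left(\frac1\rho\right),\qquad \chi_2(s)=\sum_{n\ge 0}\frac{s^{2n+1}}{(2n+1)^2}.$$
   Context: $O$ is the origin of $\mathbb{R}^2$. $P(\text{obtuse})$ is the probability that $P_1,P_2,P_3$ form a (non-degenerate) triangle that is obtuse, i.e. has some interior angle exceeding $\pi/2$. The function $\chi_2$ is the Legendre chi function. *)

(* Defs.v *)
From HB Require Import structures.
From mathcomp Require Import all_boot all_order all_algebra.
From mathcomp Require Import all_classical all_reals all_analysis.

Set Implicit Arguments.
Unset Strict Implicit.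
Unset Printing Implicit Defensive.

Import Order.TTheory GRing.Theory Num.Theory.
Import numFieldNormedType.Exports.

Local Open Scope classical_set_scope.
Local Open Scope ring_scope.

Section plane_geometry.
Context {R : realType}.
Implicit Types u v A B C : R * R.

(* The library norm on [R * R] is the maximum norm, hence an explicit
   Euclidean structure. *)
Definition dot u v : R := u.1 * v.1 + u.2 * v.2.

Definition enorm u : R := Num.sqrt (dot u u).

(* The angle at the vertex [A]. *)
Definition interior_angle A B C : R :=
  acos (dot (B - A) (C - A) / (enorm (B - A) * enorm (C - A))).

Definition on_line (a b c : R) A : Prop := a * A.1 + b * A.2 = c.

Definition collinear A B C : Prop :=
  exists a b c : R, (a, b) <> (0, 0) /\
    [/\ on_line a b c A, on_line a b c B & on_line a b c C].

Definition obtuse A B C : Prop :=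
  ~ collinear A B C /\
  [\/ pi / 2 < interior_angle A B C,
      pi / 2 < interior_angle B C A |
      pi / 2 < interior_angle C A B].

End plane_geometry.

Section random_points.
Context {R : realType}.

Definition circle_point (r theta : R) : R * R :=
  (r * cos theta, r * sin theta).

Lemma lt0_2pi : 0 < 2 * pi :> R.
Proof. by rewrite mulr_gt0 ?pi_gt0. Qed.

(* The law of the point of the circle of radius [r] about the origin whose
   polar angle is uniform on [0, 2 pi]. *)
Definition uniform_circle (r : R) : set (R * R) -> \bar R :=
  pushforward (uniform_prob lt0_2pi) (circle_point r).

Definition uniform_on_circle d (T : measurableType d) (P : probability T R)
    (r : R) (X : {RV P >-> (R * R)%type}) : Prop :=
  forall A, measurable A -> distribution P X A = uniform_circle r A.

Definition mutually_independent d (T : measurableType d) (P : probability T R)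
    (I : finType) d' (T' : measurableType d') (X : I -> {RV P >-> T'}) : Prop :=
  forall (J : {set I}) (A : I -> set T'), (forall i, measurable (A i)) ->
    P (\bigcap_(i in [set` J]) (X i @^-1` A i)) =
    (\prod_(i in J) P (X i @^-1` A i))%E.

End random_points.

Definition legendre_chi2 {R : realType} (s : R) : R :=
  limn (series (fun n : nat => s ^+ (2 * n + 1) / (2 * n + 1)%:R ^+ 2)).

(* Main.v *)
Require Import Defs.
From HB Require Import structures.
From mathcomp Require Import all_boot all_order all_algebra.
From mathcomp Require Import all_classical all_reals all_analysis.
From mathcomp Require Import measurable_realfun.
From mathcomp Require Import ring lra.

Import Order.TTheory GRing.Theory Num.Theory.
Import numFieldNormedType.Exports.

Local Open Scope classical_set_scope.
Local Open Scope ring_scope.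

Set Implicit Arguments.
Unset Strict Implicit.
Unset Printing Implicit Defensive.

(** Call [s = 1 / rho]. By rotation invariance the probability is the mean,
    over the angle [gamma] from [P_1] to [P_3], of the conditional probability
    that the triangle is obtuse when [P_1] sits at angle 0, [P_3] at angle
    [gamma] and [P_2] at a uniform angle [beta]. The angle at [P_3] is never
    obtuse because [rho ^ 2 >= 2]: a distance of at least [sqrt 2] puts [P_3]
    out of every open disc having a chord of the unit circle as diameter.

    With [beta = pi - 2 y] and [t = tan y], the angle at [P_1] is obtuse iff
    [t * sin gamma < cos gamma - s], and the angle at [P_2] iff
    [cos gamma + s < t * sin gamma]. Hence, if [sin gamma] is nonzero, and up to
    finitely many [beta], the triangle fails to be obtuse exactly for [t] between the two numbers
    [(cos gamma - s) / sin gamma] and [(cos gamma + s) / sin gamma], so [P_2]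
    ranges over an arc of length [2 * |h|], where
    [h = atan ((cos gamma + s) / sin gamma) - atan ((cos gamma - s) / sin gamma)]
    ([uniform_obtuse_arc]).

    The function [h] has the expansion
    [h = 2 * sum_n s ^ (2 n + 1) * sin ((2 n + 1) gamma) / (2 n + 1)],
    with an error which is geometric in the number of terms and uniform in
    [gamma]: after differentiation in [s] both sides are explicit, and their
    difference is a finite geometric sum ([half_arc_approx]). Integrating [|h|]
    term by term over [[0, pi]] and [[pi, 2 pi]], where [h] has a constant
    sign, each term contributes [8 s ^ (2 n + 1) / (2 n + 1) ^ 2]. The total is
    [8 chi_2(s)], and dividing by [pi] and by the length [2 pi] gives the
    subtracted term [4 / pi ^ 2 * chi_2(s)].

    The passage from the random points to independent uniform angles is
    [joint_law3] followed by Tonelli's theorem; rotation invariance is the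
    translation invariance of the integral of a periodic function over a period
    ([ge0_integral_periodic]). *)

(** * Obtuse triangles with vertices on two concentric circles *)

Section geometry.
Context {R : realType}.
Implicit Types A B C : R * R.

(** Twice the signed area of the triangle [A B C]. *)
Definition cross A B C : R :=
  (B.1 - A.1) * (C.2 - A.2) - (B.2 - A.2) * (C.1 - A.1).

Lemma collinearE A B C : collinear A B C <-> cross A B C = 0.
Proof.
rewrite /collinear /on_line /cross.
case: A => a1 a2; case: B => b1 b2; case: C => c1 c2 /=; split.
  move=> [a [b [c [ab0 [hA hB hC]]]]].
  set D := (X in X = 0).
  have aD : a * D = 0.
    transitivity ((c2 - a2) * ((a * b1 + b * b2) - (a * a1 + b * a2)) -
      (b2 - a2) * ((a * c1 + b * c2) - (a * a1 + b * a2))); first by rewrite /D; ring.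
    by rewrite hA hB hC subrr !mulr0 subrr.
  have bD : b * D = 0.
    transitivity ((b1 - a1) * ((a * c1 + b * c2) - (a * a1 + b * a2)) -
      (c1 - a1) * ((a * b1 + b * b2) - (a * a1 + b * a2))); first by rewrite /D; ring.
    by rewrite hA hB hC subrr !mulr0 subrr.
  apply/eqP; apply: contra_notT ab0 => D0.
  move/eqP: aD; rewrite mulf_eq0 (negbTE D0) orbF => /eqP ->.
  by move/eqP: bD; rewrite mulf_eq0 (negbTE D0) orbF => /eqP ->.
move=> D0.
(* If [A] and [B] coincide, the line through [A] and [C] is taken, and any line
   through [A] if the three points coincide. *)
have [[]|BA] := pselect (b1 = a1 /\ b2 = a2).
  move=> -> ->; have [[-> ->]|CA] := pselect (c1 = a1 /\ c2 = a2).
    exists 1, 0, a1; split; last by split; ring.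
    by move=> [] /eqP; rewrite oner_eq0.
  exists (a2 - c2), (c1 - a1), ((a2 - c2) * a1 + (c1 - a1) * a2); split.
    move=> [] /eqP; rewrite subr_eq0 => /eqP e1 /eqP; rewrite subr_eq0 => /eqP e2.
    by apply: CA.
  by split => //; ring.
exists (a2 - b2), (b1 - a1), ((a2 - b2) * a1 + (b1 - a1) * a2); split.
  move=> [] /eqP; rewrite subr_eq0 => /eqP e1 /eqP; rewrite subr_eq0 => /eqP e2.
  by apply: BA.
by split; [ring|ring|lra].
Qed.

Lemma dot_ge0 A : 0 <= dot A A.
Proof. by rewrite addr_ge0// -expr2 sqr_ge0. Qed.

Lemma dot_eq0 A : dot A A = 0 -> A = (0, 0).
Proof.
case: A => a b; rewrite /dot /= -!expr2 => /eqP.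
by rewrite paddr_eq0 ?sqr_ge0// !sqrf_eq0 => /andP[/eqP-> /eqP->].
Qed.

Lemma enorm_gt0 A : A <> (0, 0) -> 0 < enorm A.
Proof.
move=> A0; rewrite /enorm sqrtr_gt0 lt_neqAle dot_ge0 andbT.
by apply/eqP => /esym/dot_eq0.
Qed.

Lemma gt_pihalf_acos (x : R) : -1 <= x <= 1 -> (pi / 2 < acos x) <-> x < 0.
Proof.
move=> x1; rewrite -acos0.
have acos_itv y : -1 <= y <= 1 -> acos y \in `[0, (pi : R)].
  by move=> y1; rewrite in_itv/= acos_ge0// acos_lepi.
have n101 : -1 <= (0 : R) <= 1 by rewrite lerN10 ler01.
by rewrite -ltr_cos ?acos_itv// !acosK// in_itv.
Qed.

Lemma cauchy_schwarz_dot A B : `|dot A B| <= enorm A * enorm B.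
Proof.
rewrite /enorm -sqrtrM ?dot_ge0// -sqrtr_sqr ler_sqrt ?mulr_ge0 ?dot_ge0//.
case: A => a b; case: B => c e; rewrite /dot /=.
have := sqr_ge0 (a * e - b * c); lra.
Qed.

Lemma obtuse_angleE A B C : B <> A -> C <> A ->
  (pi / 2 < interior_angle A B C) <-> dot (B - A) (C - A) < 0.
Proof.
have sub0 (u v : R * R) : u <> v -> u - v <> (0, 0).
  case: u => u1 u2; case: v => v1 v2 uv -[/eqP + /eqP].
  by rewrite !subr_eq0 => /eqP e1 /eqP e2; apply: uv; rewrite e1 e2.
move=> /sub0/enorm_gt0 BA /sub0/enorm_gt0 CA; rewrite /interior_angle.
have N0 : 0 < enorm (B - A) * enorm (C - A) by rewrite mulr_gt0.
rewrite gt_pihalf_acos; first by rewrite pmulr_llt0 ?invr_gt0.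
by rewrite -ler_norml normrM normfV (gtr0_norm N0) ler_pdivrMr// mul1r
  cauchy_schwarz_dot.
Qed.

Lemma obtuseE A B C : obtuse A B C <->
  cross A B C != 0 /\ [\/ dot (B - A) (C - A) < 0, dot (C - B) (A - B) < 0 |
    dot (A - C) (B - C) < 0].
Proof.
rewrite /obtuse collinearE.
suff H : cross A B C <> 0 ->
    [\/ pi / 2 < interior_angle A B C, pi / 2 < interior_angle B C A |
      pi / 2 < interior_angle C A B] <->
    [\/ dot (B - A) (C - A) < 0, dot (C - B) (A - B) < 0 |
      dot (A - C) (B - C) < 0].
  by split=> -[D0 h]; split=> //; [exact/eqP|apply/H| |apply/H] => //; exact/eqP.
move=> D0.
have AB : B <> A by move=> e; apply: D0; rewrite e /cross; ring.
have BC : C <> B by move=> e; apply: D0; rewrite e /cross; ring.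
have AC : C <> A by move=> e; apply: D0; rewrite e /cross; ring.
have [[AB' BC'] AC'] := (nesym AB, nesym BC, nesym AC).
have [h1 h2] := obtuse_angleE AB AC; have [h3 h4] := obtuse_angleE BC AB'.
have [h5 h6] := obtuse_angleE AC' BC'.
split=> -[h|h|h].
- by apply: Or31; exact: h1.
- by apply: Or32; exact: h3.
- by apply: Or33; exact: h5.
- by apply: Or31; exact: h2.
- by apply: Or32; exact: h4.
- by apply: Or33; exact: h6.
Qed.

(** In the next four definitions [P_1] and [P_2] are the points of the unit circle
    at angles 0 and [beta], and [P_3] is the point of the circle of radius [rho]
    at angle [gamma]. First, the dot product whose sign is that of the cosine
    of the angle at [P_1]. *)
Definition arc_dot1 (rho beta gamma : R) : R :=
  rho * cos (gamma - beta) - cos beta - rho * cos gamma + 1.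

(** The same for the angle at [P_2]. *)
Definition arc_dot2 (rho beta gamma : R) : R :=
  rho * cos gamma - cos beta - rho * cos (gamma - beta) + 1.

(** The value of [cross] on [P_1], [P_2], [P_3]. *)
Definition arc_cross (rho beta gamma : R) : R :=
  sin beta + rho * sin (gamma - beta) - rho * sin gamma.

(** The triangle [P_1 P_2 P_3] is nondegenerate with an obtuse angle at [P_1] or
    [P_2]. *)
Definition arc_obtuse (rho beta gamma : R) : Prop :=
  arc_cross rho beta gamma != 0 /\
  (arc_dot1 rho beta gamma < 0 \/ arc_dot2 rho beta gamma < 0).

(** Obtuseness depends on the angles only through differences, and the angle
    at [P_3] plays no part when [rho ^ 2 >= 2]. *)
Lemma obtuse_circle_point (rho a b c : R) : 2 <= rho ^+ 2 ->
  obtuse (circle_point 1 a) (circle_point 1 b) (circle_point rho c) <->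
  arc_obtuse rho (b - a) (c - a).
Proof.
move=> rho2; rewrite obtuseE /arc_obtuse.
have cosD' (x y : R) : cos (x - y) = cos x * cos y + sin x * sin y by rewrite cosB.
have sinD' (x y : R) : sin (x - y) = sin x * cos y - cos x * sin y by rewrite sinB.
have e0 : c - a - (b - a) = c - b by lra.
have csa := cos2Dsin2 a; have csb := cos2Dsin2 b; have csc := cos2Dsin2 c.
have -> : cross (circle_point 1 a) (circle_point 1 b) (circle_point rho c) =
    arc_cross rho (b - a) (c - a).
  rewrite /cross /arc_cross e0 !sinD' /=; ring.
have -> : dot (circle_point 1 b - circle_point 1 a)
    (circle_point rho c - circle_point 1 a) = arc_dot1 rho (b - a) (c - a).
  rewrite /dot /arc_dot1 e0 !cosD' /=; lra.
have -> : dot (circle_point rho c - circle_point 1 b)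
    (circle_point 1 a - circle_point 1 b) = arc_dot2 rho (b - a) (c - a).
  rewrite /dot /arc_dot2 e0 !cosD' /=; lra.
split=> -[? H]; split => //; last by case: H => h; [apply: Or31|apply: Or32].
case: H => [|/=|]; [by left|by right|].
rewrite /dot /= => H; exfalso.
(* [0 <= |P_3 - P_1 - P_2| ^ 2] bounds the dot product at [P_3] from below by
   [rho ^ 2 / 2 - 1]. *)
have H1 := sqr_ge0 (rho * cos c - cos a - cos b).
have H2 := sqr_ge0 (rho * sin c - sin a - sin b).
have H3 : rho ^+ 2 * (cos c ^+ 2 + sin c ^+ 2) = rho ^+ 2 by rewrite csc mulr1.
lra.
Qed.

End geometry.

(** * Integrals of periodic functions *)

Section periodic_integral.
Local Open Scope ereal_scope.
Context {R : realType}.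
Notation mu := (@lebesgue_measure R).

Lemma measurable_addr (t : R) :
  measurable_fun [set: measurableTypeR R] (fun x => (x + t)%R : measurableTypeR R).
Proof. exact: measurable_funD. Qed.

Lemma lebesgue_measure_addr (t : R) (A : set R) : measurable A ->
  pushforward mu (fun x => (x + t)%R : measurableTypeR R) A = mu A.
Proof.
move=> mA; apply/esym/lebesgue_measure_unique => //=.
  exact: measurable_addr.
move=> mf _ [[a b]] _ <-.
rewrite /= /pushforward.

have -> : (fun x => (x + t)%R) @^-1` `]a, b] = `](a - t)%R, (b - t)%R]%classic.
  by apply/seteqP; split=> x /=; rewrite !in_itv/= ltrBlDr lerBrDr.
rewrite !lebesgue_measure_itv/= !lte_fin ltrD2r; case: ifPn => // _.
by rewrite -!EFinD; congr EFin; rewrite opprB addrA subrK.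
Qed.

Lemma ge0_integral_addr (f : R -> \bar R) (a b t : R) :
  measurable_fun [set: R] f -> (forall x, 0 <= f x) ->
  \int[mu]_(x in `[a, b]) f (x + t)%R = \int[mu]_(x in `[(a + t)%R, (b + t)%R]) f x.
Proof.
move=> mf f0.
have -> : `[a, b]%classic = (fun x => (x + t)%R) @^-1` `[(a + t)%R, (b + t)%R].
  by apply/seteqP; split=> x /=; rewrite !in_itv/= !lerD2r.
rewrite -(ge0_integral_pushforward (measurable_addr t))//; last exact: measurable_funS mf.
apply: eq_measure_integral => [|mt A mA _]; first exact: measurable_addr.
by rewrite /= lebesgue_measure_addr.
Qed.

Lemma ge0_integral_itvcc_split (f : R -> \bar R) (a b c : R) :
  measurable_fun [set: R] f -> (forall x, 0 <= f x) -> (a <= b <= c)%R ->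
  \int[mu]_(x in `[a, c]) f x =
  \int[mu]_(x in `[a, b]) f x + \int[mu]_(x in `[b, c]) f x.
Proof.
move=> mf f0 /andP[ab bc].
have mfS (D : set R) : measurable_fun D f by exact: measurable_funS mf.
rewrite (@itv_bndbnd_setU _ _ _ (BLeft b)) ?bnd_simp//.
rewrite ge0_integral_setU//; first by rewrite integral_itv_bndo_bndc.
 exact: mfS.
rewrite disj_set2E; apply/eqP/seteqP; split=> x //= [].
by rewrite !in_itv/= => /andP[_ xb] /andP[bx _]; move: xb; rewrite ltNge bx.
Qed.

Lemma ge0_integral_periodic_le (f : R -> \bar R) (p t : R) :
  measurable_fun [set: R] f -> (forall x, 0 <= f x) ->
  (forall x, f (x + p)%R = f x) -> (0 <= t <= p)%R ->
  \int[mu]_(x in `[0%R, p]) f (x + t)%R = \int[mu]_(x in `[0%R, p]) f x.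
Proof.
move=> mf f0 fp /andP[t0 tp]; rewrite ge0_integral_addr// add0r.
rewrite (@ge0_integral_itvcc_split _ t p)//; last by rewrite tp lerDl.
rewrite [RHS](@ge0_integral_itvcc_split _ _ t)//; last by rewrite t0 tp.
rewrite addeC; congr (_ + _).
have := @ge0_integral_addr f 0 t p mf f0.
by rewrite add0r [(t + p)%R]addrC => <-; apply: eq_integral => x _; rewrite fp.
Qed.

Lemma ge0_integral_periodic (f : R -> \bar R) (p t : R) : (0 < p)%R ->
  measurable_fun [set: R] f -> (forall x, 0 <= f x) ->
  (forall x, f (x + p)%R = f x) ->
  \int[mu]_(x in `[0%R, p]) f (x + t)%R = \int[mu]_(x in `[0%R, p]) f x.
Proof.
move=> p0 mf f0 fp.
have fpn n x : f (x + n%:R * p)%R = f x.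
  by elim: n x => [|n ih] x; rewrite ?mul0r ?addr0// -natr1 mulrDl mul1r addrA fp ih.
have fpz (n : int) x : f (x + n%:~R * p)%R = f x.
  case: n => n; first by rewrite -[Posz n]/(n%:Z) -pmulrn fpn.
  by rewrite NegzE rmorphN /= mulNr -(fpn n.+1) -pmulrn subrK.
pose n := Num.floor (t / p)%R.
have -> : (t = (t - n%:~R * p) + n%:~R * p)%R by rewrite subrK.
under eq_integral do rewrite addrA fpz.
apply: ge0_integral_periodic_le => //.
have /andP[n1 n2] := mem_rg1_floor (t / p)%R.
by apply/andP; split; move: n1 n2; rewrite /n -?intrD1 ler_pdivlMr// ltr_pdivrMr//; lra.
Qed.

End periodic_integral.

(** * Joint laws of independent variables *)

Section product_laws.
Local Open Scope ereal_scope.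
Context {R : realType}.

(** Uniqueness of measures on the pi-system of rectangles. *)
Lemma eq_finite_measure_rectangle d1 d2 (T1 : measurableType d1)
    (T2 : measurableType d2) (m m' : {measure set (T1 * T2) -> \bar R}) :
  m setT < +oo ->
  (forall A B, measurable A -> measurable B -> m (A `*` B) = m' (A `*` B)) ->
  forall S, measurable S -> m S = m' S.
Proof.
move=> moo mm' S mS.
pose C : set (set (T1 * T2)) := [set A1 `*` A2 | A1 in measurable & A2 in measurable].
apply: (measure_unique C (fun=> setT)) => //.
- by rewrite measurable_prod_measurableType.
- move=> X Y [X1 mX1 [X2 mX2 <-{X}]] [Y1 mY1 [Y2 mY2 <-{Y}]].
  exists (X1 `&` Y1); first exact: measurableI.
  by exists (X2 `&` Y2); [exact: measurableI|rewrite setXI].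
- by move=> _; exists setT => //; exists setT => //; rewrite setXTT.
- by rewrite bigcup_const.
- by move=> _ [A mA [B mB <-]]; exact: mm'.
Qed.

Context d d1 d2 d3 (T : measurableType d)
  (T1 : measurableType d1) (T2 : measurableType d2) (T3 : measurableType d3).
Variables (P : probability T R) (m1 : probability T1 R)
  (m2 : probability T2 R) (m3 : probability T3 R).
Variables (X : T -> T1) (Y : T -> T2) (Z : T -> T3).
Hypotheses (mX : measurable_fun setT X) (mY : measurable_fun setT Y)
  (mZ : measurable_fun setT Z).

(** The joint law of three independent variables is the product of their laws.
    The first two are grouped, so that for a fixed event on the third one the
    statement reduces to two measures that agree on rectangles. *)
Lemma joint_law3 :
  (forall A B C, measurable A -> measurable B -> measurable C ->
    P (X @^-1` A `&` Y @^-1` B `&` Z @^-1` C) = m1 A * m2 B * m3 C) ->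
  forall S, measurable S ->
    P ((fun t => ((X t, Y t), Z t)) @^-1` S) = ((m1 \x m2) \x m3) S.
Proof.
move=> indep S mS.
have mXY : measurable_fun setT (fun t => (X t, Y t)) by exact/measurable_fun_pair.
have mXYZ : measurable_fun setT (fun t => ((X t, Y t), Z t)).
  exact/measurable_fun_pair.
have mpre d' (T' : measurableType d') (f : T -> T') A :
    measurable_fun setT f -> measurable A -> measurable (f @^-1` A).
  by move=> mf mA; rewrite -[X in measurable X]setTI; exact: mf.
transitivity (pushforward P (fun t => ((X t, Y t), Z t)) S) => //.
apply: eq_finite_measure_rectangle => //=.
  by rewrite /pushforward preimage_setT probability_setT ltry.
move=> A C mA mC; rewrite [RHS]product_measure1E//.

have mZC := mpre _ _ _ _ mZ mC.
pose k : {nonneg R} := NngNum (fine_ge0 (measure_ge0 m3 C)).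
have kE : k%:num%:E = m3 C by rewrite fineK// fin_num_measure.
transitivity (mscale k (m1 \x m2) A); last by rewrite /mscale kE muleC.
transitivity (pushforward (mrestr P mZC) (fun t => (X t, Y t)) A) => //.
apply: eq_finite_measure_rectangle => //=.
  rewrite /pushforward /mrestr /= (le_lt_trans (probability_le1 P _)) ?ltry//.
  by rewrite preimage_setT setTI.
move=> A' B' mA' mB'; rewrite /mscale kE.
have e := @product_measure1E _ _ _ _ _ m1 m2 _ _ mA' mB'.
by rewrite muleC [X in _ = X * _]e -indep.
Qed.
End product_laws.

(** * Reduction to one uniform angle *)

Section circle_laws.
Context {R : realType}.
Notation U := (uniform_prob (@lt0_2pi R)).

Lemma measurable_circle_point (r : R) :
  measurable_fun [set: measurableTypeR R] (circle_point r).
Proof.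
apply/measurable_fun_pair => /=; apply: measurable_funM => //;
  apply: continuous_measurable_fun; [exact: continuous_cos|exact: continuous_sin].
Qed.

Lemma integral_uniform_on_circle d (T : measurableType d) (P : probability T R)
    (r : R) (X : {RV P >-> (R * R)%type}) (f : R * R -> \bar R) :
  uniform_on_circle r X -> measurable_fun setT f -> (forall x, 0 <= f x)%E ->
  (\int[distribution P X]_x f x = \int[U]_theta f (circle_point r theta))%E.
Proof.
move=> hX mf f0.
transitivity (\int[pushforward U (circle_point r)]_x f x)%E; last first.
  by rewrite (ge0_integral_pushforward (measurable_circle_point r)).
by apply: eq_measure_integral => [|mg A mA _]; [exact: measurable_circle_point|exact: hX].
Qed.

Lemma integral_uniform_addr (f : R -> \bar R) (t : R) :
  measurable_fun setT f -> (forall x, 0 <= f x)%E ->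
  (forall x, f (x + 2 * pi) = f x) ->
  (\int[U]_x f (x + t)%R = \int[U]_x f x)%E.
Proof.
move=> mf f0 fp.
rewrite !integral_uniform//; last exact: (measurableT_comp mf (measurable_addr t)).
by rewrite ge0_integral_periodic// lt0_2pi.
Qed.

Lemma uniform_prob_addr (A : set R) (t : R) : measurable A ->
  (forall x, A (x + 2 * pi) <-> A x) -> U [set x | A (x + t)] = U A.
Proof.
move=> mA Ap.
have mAt : measurable [set x | A (x + t)].
  by rewrite -[X in measurable X]setTI; exact: measurable_addr.
have indE (S : set R) : measurable S -> (U S = \int[U]_x (\1_S x)%:E)%E.
  by move=> mS; rewrite integral_indic// setIT.
rewrite !indE//.
rewrite -(@integral_uniform_addr (EFin \o \1_A) t).
- by apply: eq_integral => x _; rewrite /= !indicE; congr ((nat_of_bool _)%:R%:E).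
- exact/measurable_EFinP.
- by move=> x; rewrite lee_fin.
- move=> x /=; rewrite !indicE; congr ((nat_of_bool _)%:R%:E).
  by apply/idP/idP; rewrite !inE => /Ap.
Qed.

End circle_laws.

Section measurable_obtuse.
Context {R : realType} d (T : measurableType d).
Variables A B C : T -> R * R.
Hypotheses (mA : measurable_fun setT A) (mB : measurable_fun setT B)
  (mC : measurable_fun setT C).

Lemma measurable_obtuse : measurable [set t | obtuse (A t) (B t) (C t)].
Proof.
have mfst (f : T -> R * R) : measurable_fun setT f ->
    measurable_fun setT (fun t => (f t).1).
  by move=> mf; exact: (measurableT_comp measurable_fst mf).
have msnd (f : T -> R * R) : measurable_fun setT f ->
    measurable_fun setT (fun t => (f t).2).
  by move=> mf; exact: (measurableT_comp measurable_snd mf).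
have mdot (f g h : T -> R * R) : measurable_fun setT f -> measurable_fun setT g ->
    measurable_fun setT h -> measurable [set t | dot (g t - f t) (h t - f t) < 0].
  move=> mf mg mh; set D := (fun t => dot (g t - f t) (h t - f t)).
  have mD : measurable_fun setT D.
    by apply: measurable_funD; apply: measurable_funM; apply: measurable_funB;
      (apply: mfst || apply: msnd).
  rewrite [X in measurable X](_ : _ = D @^-1` `]-oo, 0[); last first.
    by apply/seteqP; split=> t /=; rewrite in_itv.
  by rewrite -[X in measurable X]setTI; exact: mD.
have mcross : measurable_fun setT (fun t => cross (A t) (B t) (C t)).
  by apply: measurable_funB; apply: measurable_funM; apply: measurable_funB;
    (apply: mfst || apply: msnd).
rewrite [X in measurable X](_ : _ =
  ~` ((fun t => cross (A t) (B t) (C t)) @^-1` [set 0]) `&`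
  ([set t | dot (B t - A t) (C t - A t) < 0] `|`
   [set t | dot (C t - B t) (A t - B t) < 0] `|`
   [set t | dot (A t - C t) (B t - C t) < 0])); last first.
  apply/seteqP; split=> t /=.
    by move=> /obtuseE[/eqP ? []]; split => //; [left;left|left;right|right].
  move=> [/eqP ? H]; apply/obtuseE; split => //.
  by case: H => [[]|] h; [apply: Or31|apply: Or32|apply: Or33].
apply: measurableI; first apply: measurableC.
  by rewrite -[X in measurable X]setTI; exact: mcross.
by apply: measurableU; [apply: measurableU|]; apply: mdot.
Qed.
End measurable_obtuse.

Section reduction.
Context {R : realType}.
Notation U := (uniform_prob (@lt0_2pi R)).

(** The angles [beta] of [P_2] that make the triangle obtuse, when [P_1] is at
    angle 0 and [P_3] at angle [gamma]. *)
Definition obtuse_arc (rho gamma : R) : set R := [set beta | arc_obtuse rho beta gamma].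

Lemma arc_obtuseD2pil (rho beta gamma : R) :
  arc_obtuse rho (beta + 2 * pi) gamma <-> arc_obtuse rho beta gamma.
Proof.
have e : 2 * pi = pi *+ 2 :> R by rewrite mulr_natl.
have e1 : gamma - beta = gamma - (beta + pi *+ 2) + pi *+ 2 by ring.
by rewrite /arc_obtuse /arc_cross /arc_dot1 /arc_dot2 e e1 !cosD2pi !sinD2pi.
Qed.

Lemma arc_obtuseD2pir (rho beta gamma : R) :
  arc_obtuse rho beta (gamma + 2 * pi) <-> arc_obtuse rho beta gamma.
Proof.
have e : 2 * pi = pi *+ 2 :> R by rewrite mulr_natl.
have e1 : gamma + pi *+ 2 - beta = gamma - beta + pi *+ 2 by ring.
by rewrite /arc_obtuse /arc_cross /arc_dot1 /arc_dot2 e e1 !cosD2pi !sinD2pi.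
Qed.

Lemma measurable_arc_obtuse (rho : R) : 2 <= rho ^+ 2 ->
  measurable [set w : R * R | arc_obtuse rho w.2 w.1].
Proof.
move=> rho2.
rewrite [X in measurable X](_ : _ = [set w : R * R | obtuse (circle_point 1 0)
   (circle_point 1 w.2) (circle_point rho w.1)]).
  apply: measurable_obtuse => //.
    exact: (measurableT_comp (measurable_circle_point _) measurable_snd).
  exact: (measurableT_comp (measurable_circle_point _) measurable_fst).
apply/seteqP; split=> w /=; rewrite obtuse_circle_point//.
all: by rewrite !subr0.
Qed.

Lemma obtuse_arcE (rho gamma : R) :
  obtuse_arc rho gamma = xsection [set w : R * R | arc_obtuse rho w.2 w.1] gamma.
Proof. by apply/seteqP; split=> b; rewrite /xsection /= inE. Qed.

Lemma measurable_obtuse_arc (rho gamma : R) : 2 <= rho ^+ 2 ->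
  measurable (obtuse_arc rho gamma).
Proof.
move=> rho2; rewrite obtuse_arcE; apply: measurable_xsection.
exact: measurable_arc_obtuse.
Qed.

Lemma measurable_fun_obtuse_arc (rho : R) : 2 <= rho ^+ 2 ->
  measurable_fun setT (fun gamma => U (obtuse_arc rho gamma)).
Proof.
move=> rho2; under eq_fun do rewrite obtuse_arcE.
by apply: measurable_fun_xsection; exact: measurable_arc_obtuse.
Qed.

(** The probability of an obtuse triangle is the mean over [gamma] of the
    conditional probability of [obtuse_arc rho gamma]. *)
Lemma probability_obtuse d (T : measurableType d) (P : probability T R)
    (rho : R) (X Y Z : {RV P >-> (R * R)%type}) : 2 <= rho ^+ 2 ->
  uniform_on_circle 1 X -> uniform_on_circle 1 Y -> uniform_on_circle rho Z ->
  (forall A B C, measurable A -> measurable B -> measurable C ->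
    P (X @^-1` A `&` Y @^-1` B `&` Z @^-1` C) =
    P (X @^-1` A) * P (Y @^-1` B) * P (Z @^-1` C))%E ->
  (P [set t | obtuse (X t) (Y t) (Z t)] = \int[U]_gamma U (obtuse_arc rho gamma))%E.
Proof.
move=> rho2 hX hY hZ indep.
(* [Z] precedes [Y] in the triple, so that the innermost integral is over [Y]. *)
pose S : set ((R * R) * (R * R) * (R * R)) := [set w | obtuse w.1.1 w.2 w.1.2].
have mS : measurable S.
  apply: measurable_obtuse => //.
    exact: (measurableT_comp measurable_fst measurable_fst).
  exact: (measurableT_comp measurable_snd measurable_fst).
have -> : [set t | obtuse (X t) (Y t) (Z t)] = (fun t => ((X t, Z t), Y t)) @^-1` S by [].
rewrite (@joint_law3 _ _ _ _ _ _ _ _ _ _ (distribution P X) (distribution P Z)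
   (distribution P Y))//; last first.
  by move=> A B C mA mB mC; rewrite setIAC indep// muleAC.
rewrite /product_measure1.
pose f w := distribution P Y (xsection S w).
have mf : measurable_fun setT f by exact: measurable_fun_xsection.
have f0 w : (0 <= f w)%E by exact: measure_ge0.
rewrite (fubini_tonelli1 f)// /fubini_F.
have mF := measurable_fun_fubini_tonelli_F f mf f0 (m2 := distribution P Z).
rewrite (integral_uniform_on_circle hX)//; last first.
  by move=> x; apply: integral_ge0.
under eq_integral => a _.
  rewrite (integral_uniform_on_circle hZ)//; last by apply: measurableT_comp.
  under eq_integral => c _.
    rewrite /f hY; last exact: measurable_xsection.
    rewrite (_ : uniform_circle _ _ = U (obtuse_arc rho (c - a))); last first.
      (* Rotating by [- a] moves [P_1] to angle 0. *)
      rewrite -(@uniform_prob_addr _ _ (- a)).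
      - congr (U _); apply/seteqP; split=> b /=; rewrite /xsection /= inE /S /=;
        by rewrite obtuse_circle_point.
      - exact: measurable_obtuse_arc.
      - by move=> x; exact: arc_obtuseD2pil.
    over.
  rewrite (@integral_uniform_addr _ (fun c => U (obtuse_arc rho c)) (- a))//; last 2 first.
    exact: measurable_fun_obtuse_arc.
    move=> c; congr (U _); apply/seteqP; split=> b.
      exact: (arc_obtuseD2pir _ _ _).1.
    exact: (arc_obtuseD2pir _ _ _).2.
  over.
rewrite integral_cst//= [X in (_ * X)%E](_ : _ = 1%E) ?mule1//.
exact: (@probability_setT _ _ _ U).
Qed.
End reduction.

(** * Length of the arc of non-obtuse positions *)

Section arc_length.
Context {R : realType}.
Notation U := (uniform_prob (@lt0_2pi R)).
Implicit Types rho beta gamma s : R.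

(** Half the signed length of the arc of positions of [P_2] for which the
    triangle is not obtuse, where [s = 1 / rho] and [sin gamma != 0]; its sign
    is that of [sin gamma]. *)
Definition half_arc s gamma : R :=
  atan ((cos gamma + s) / sin gamma) - atan ((cos gamma - s) / sin gamma).

(** In terms of [t = tan ((pi - beta) / 2)] the two dot products and the area are
    affine, up to a positive factor. *)
Lemma arc_obtuse_tan rho beta gamma : 0 < rho -> 0 < beta < 2 * pi ->
  arc_obtuse rho beta gamma <->
  [/\ tan ((pi - beta) / 2) * (1 - rho * cos gamma) != rho * sin gamma &
   sin gamma * tan ((pi - beta) / 2) < cos gamma - 1 / rho \/
   cos gamma + 1 / rho < sin gamma * tan ((pi - beta) / 2)].
Proof.
move=> rho0 /andP[b0 b2].
set y := (pi - beta) / 2; set t := tan y.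
have cy0 : 0 < cos y by apply: cos_gt0_pihalf; rewrite /y; lra.
have syE : sin y = t * cos y by rewrite /t /tan divfK// gt_eqF.
have betaE : beta = pi - (y + y) by rewrite /y; lra.
have cb : cos beta = 1 - 2 * cos y ^+ 2.
  rewrite betaE cosB cospi sinpi mul0r addr0 mulN1r cosD.
  have := cos2Dsin2 y; lra.
have sb : sin beta = 2 * t * cos y ^+ 2.
  by rewrite betaE sinB cospi sinpi mul0r add0r sinD syE; ring.
have r2 : 0 < 2 * cos y ^+ 2 by rewrite mulr_gt0// exprn_gt0.
have d1 : arc_dot1 rho beta gamma =
    2 * cos y ^+ 2 * rho * (1 / rho - cos gamma + sin gamma * t).
  by rewrite /arc_dot1 cosB cb sb; field; rewrite gt_eqF.
have d2 : arc_dot2 rho beta gamma =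
    2 * cos y ^+ 2 * rho * (cos gamma + 1 / rho - sin gamma * t).
  by rewrite /arc_dot2 cosB cb sb; field; rewrite gt_eqF.
have cr : arc_cross rho beta gamma =
    2 * cos y ^+ 2 * (t * (1 - rho * cos gamma) - rho * sin gamma).
  by rewrite /arc_cross sinB cb sb; ring.
rewrite /arc_obtuse d1 d2 cr !pmulr_rlt0 ?mulr_gt0// mulf_eq0 (gt_eqF r2) /= subr_eq0.
rewrite subr_lt0.
have -> : (1 / rho - cos gamma + sin gamma * t < 0) =
   (sin gamma * t < cos gamma - 1 / rho) by apply/idP/idP; lra.
by split=> -[].
Qed.

Lemma uniform_probE (A : set R) : measurable A ->
  U A = ((2 * pi)^-1%:E * lebesgue_measure (A `&` `[0%R, (2 * pi)%R]))%E.
Proof.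
move=> mA; have -> : U A = (\int[U]_x (\1_A x)%:E)%E by rewrite integral_indic// setIT.
have mA1 : measurable_fun setT (fun x => (\1_A x : R)%:E) by exact/measurable_EFinP.
have A10 x : (0 <= (\1_A x : R)%:E)%E by rewrite lee_fin.
rewrite integral_uniform//.
by rewrite subr0 integral_indic.
Qed.

Lemma lebesgue_measure_setU_seq (A : set R) (s : seq R) : measurable A ->
  lebesgue_measure (A `|` [set` s]) = lebesgue_measure A.
Proof.
move=> mA.
have cs : countable [set` s] by apply: finite_set_countable.
rewrite measureU0//; first by apply: countable_measurable.
by apply: countable_lebesgue_measure0.
Qed.

(** The conditional probability of an obtuse triangle. *)
Lemma uniform_obtuse_arc rho gamma : 0 < rho -> 2 <= rho ^+ 2 -> sin gamma != 0 ->
  U (obtuse_arc rho gamma) = (1 - `|half_arc (1 / rho) gamma| / pi)%:E.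
Proof.
move=> rho0 rho2 sg0; set s := 1 / rho.
have s0 : 0 < s by rewrite divr_gt0.
(* The two thresholds for [t], in increasing order. *)
have [u1 [u2 [u12 uabs uP]]] : exists u1 u2 : R, [/\ u1 <= u2,
    `|half_arc s gamma| = atan u2 - atan u1 &
    forall t, (sin gamma * t < cos gamma - s \/ cos gamma + s < sin gamma * t) <->
      (t < u1 \/ u2 < t)].
  rewrite /half_arc; have [sg|sg|sg] := ltgtP (sin gamma) 0.
  - exists ((cos gamma + s) / sin gamma), ((cos gamma - s) / sin gamma).
    have le12 : (cos gamma + s) / sin gamma <= (cos gamma - s) / sin gamma.
      by rewrite ler_nM2r ?invr_lt0//; lra.
    split => //.
      by rewrite ler0_norm ?opprB// subr_le0 le_atan.
    move=> t; rewrite ltr_ndivlMr// ltr_ndivrMr// ![t * _]mulrC.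
    by split=> -[]; tauto.
  - exists ((cos gamma - s) / sin gamma), ((cos gamma + s) / sin gamma).
    have le12 : (cos gamma - s) / sin gamma <= (cos gamma + s) / sin gamma.
      by rewrite ler_pM2r ?invr_gt0//; lra.
    split => //.
      by rewrite ger0_norm// subr_ge0 le_atan.
    by move=> t; rewrite ltr_pdivlMr// ltr_pdivrMr// ![t * _]mulrC.
  - by rewrite sg eqxx in sg0.
have pi0 := pi_gt0 R.
rewrite uabs uniform_probE; last exact: measurable_obtuse_arc.
have [a1 a2] := (atan_gtNpi2 u1, atan_ltpi2 u1).
have [a3 a4] := (atan_gtNpi2 u2, atan_ltpi2 u2).
have a12 : atan u1 <= atan u2 by exact: le_atan.
set p := pi - 2 * atan u2; set q := pi - 2 * atan u1.
have pq : 0 < p /\ p <= q /\ q < 2 * pi by rewrite /p /q; split; [|split]; lra.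
case: pq => [p0 [pq q2]].
(* The only angle in the open interval where the triangle can degenerate; if the
   denominator vanishes there is none, and the value of [b0] is irrelevant. *)
pose b0 := pi - 2 * atan (rho * sin gamma / (1 - rho * cos gamma)).
pose N := [:: 0; 2 * pi; b0].
have mI (a b : R) : measurable (`[a, b] : set R) by exact: measurable_itv.
have -> : lebesgue_measure (obtuse_arc rho gamma `&` `[0, 2 * pi]) =
    lebesgue_measure (`[0, 2 * pi] `\` `[p, q]).
  rewrite -(@lebesgue_measure_setU_seq _ N); last first.
    by apply: measurableI => //; exact: measurable_obtuse_arc.
  rewrite -[RHS](@lebesgue_measure_setU_seq _ N); last exact: measurableD.
  congr (lebesgue_measure _).
  have key b : 0 < b < 2 * pi -> b <> b0 -> (obtuse_arc rho gamma b <-> ~ (p <= b <= q)).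
    move=> b02 bb0; rewrite /obtuse_arc /= arc_obtuse_tan//.
    set y := (pi - b) / 2.
    have yI : y \in `](- (pi / 2)), (pi / 2)[.
      by rewrite in_itv/=; apply/andP; rewrite /y; move/andP: b02 => [? ?]; split; lra.
    have H1 : (tan y < u1 <-> q < b).
      split=> h.
        by have := lt_atan h; rewrite tanK// /q /y; lra.
      rewrite ltNge; apply/negP => h'.
      by have := le_atan h'; rewrite tanK// /y; move: h; rewrite /q; lra.
    have H2 : (u2 < tan y <-> b < p).
      split=> h.
        by have := lt_atan h; rewrite tanK// /p /y; lra.
      rewrite ltNge; apply/negP => h'.
      by have := le_atan h'; rewrite tanK// /y; move: h; rewrite /p; lra.
    split.
      move=> [_ /uP [/H1|/H2] h] /andP[h1 h2].
        by move: h; rewrite ltNge h2.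
      by move: h; rewrite ltNge h1.
    move=> /negP; rewrite negb_and -!ltNge => /orP h; split; last first.
      by apply/uP; case: h => [/H2|/H1]; [right|left].
    apply/eqP => e; apply: bb0.
    have c0 : 1 - rho * cos gamma != 0.
      apply/eqP => e0; move: e; rewrite e0 mulr0 => /esym/eqP.
      by rewrite mulf_eq0 (negbTE sg0) gt_eqF.
    by rewrite /b0 -e mulfK// tanK// /y; lra.
  apply/seteqP; split=> b /=.
    move=> [[ob b02]|bN]; [|by right].
    have [bN|bN] := boolP (b \in N); [by right|left; split => //].
    move: bN; rewrite !inE !negb_or => /and3P[/eqP h1 /eqP h2 /eqP h3].
    apply: (key b _ h3).1 => //.
    move: b02; rewrite in_itv/= !le_eqVlt.
    by move=> /andP[/orP[/eqP/esym|->] // /orP[/eqP|->]].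
  move=> [[b02 npq]|bN]; [|by right].
  have [bN|bN] := boolP (b \in N); [by right|left; split => //].
  move: bN; rewrite !inE !negb_or => /and3P[/eqP h1 /eqP h2 /eqP h3].
  apply: (key b _ h3).2; last by move: npq; rewrite in_itv.
  by move: b02; rewrite in_itv/= !le_eqVlt => /andP[/orP[/eqP/esym|->] // /orP[/eqP|->]].
rewrite measureD//=; last by rewrite lebesgue_measure_itv/= lte_fin lt0_2pi -EFinD ltry.
rewrite setIidr; last first.
  by move=> b /=; rewrite !in_itv/= => /andP[? ?]; apply/andP; split; lra.
rewrite !lebesgue_measure_itv/= !lte_fin lt0_2pi.
have -> : (if (p < q)%R then q%:E - p%:E else 0)%E = (q - p)%:E.
  case: ifPn => //; rewrite -leNgt => qp.
  by have -> : q = p; [lra|rewrite subrr].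
have fld (c x y : R) : c != 0 ->
    (2 * c)^-1 * (2 * c - (2 * y - 2 * x)) = 1 - (y - x) / c by move=> ?; field.
rewrite -!EFinD -EFinM; congr EFin; rewrite -fld ?gt_eqF//; congr (_ * _).
by rewrite /p /q; lra.
Qed.
End arc_length.

(** * Sine series of the arc length *)

Section pointwise_derivatives.
Context {R : realType}.
Implicit Types (f g : R -> R) (x c df dg : R).

Lemma is_derive1_add f g x df dg : is_derive x 1 f df -> is_derive x 1 g dg ->
  is_derive x 1 (fun s => f s + g s) (df + dg).
Proof. by move=> hf hg; exact: is_deriveD. Qed.

Lemma is_derive1_sub f g x df dg : is_derive x 1 f df -> is_derive x 1 g dg ->
  is_derive x 1 (fun s => f s - g s) (df - dg).
Proof. by move=> hf hg; exact: is_deriveB. Qed.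

Lemma is_derive1_mull c f x df : is_derive x 1 f df ->
  is_derive x 1 (fun s => c * f s) (c * df).
Proof. by move=> hf; exact: is_deriveZ. Qed.

Lemma is_derive1_exprn (n : nat) x :
  is_derive x 1 (fun s : R => s ^+ n) (n%:R * x ^+ n.-1).
Proof.
have -> : (fun s : R => s ^+ n) = id ^+ n by rewrite exprfctE.
by apply: is_derive_eq; rewrite /GRing.scale /= mulr1.
Qed.

Lemma is_derive1_affine a c x : is_derive x 1 (fun s => a + c * s) c.
Proof.
apply: (is_derive_eq (is_derive1_add (is_derive_cst a x 1)
  (is_derive1_mull c (is_derive_id x 1)))).
by rewrite mulr1 add0r.
Qed.

Lemma is_derive1_continuous f (df : R -> R) :
  (forall x, is_derive x 1 f (df x)) -> continuous f.
Proof.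
move=> hf x; apply/differentiable_continuous/derivable1_diffP.
by have [] := hf x.
Qed.
End pointwise_derivatives.

Section half_arc_series.
Context {R : realType}.
Implicit Types s x gamma : R.

(** The partial sums of the expansion of [half_arc s gamma] in powers of [s]. *)
Definition odd_sine_sum s gamma (N : nat) : R :=
  \sum_(0 <= n < N) 2 * s ^+ (2 * n + 1) / (2 * n + 1)%:R * sin ((2 * n + 1)%:R * gamma).

Lemma odd_neq0 (n : nat) : (2 * n + 1)%:R != 0 :> R.
Proof. by rewrite pnatr_eq0 addn1. Qed.

Lemma is_derive_odd_sine_sum gamma (N : nat) x :
  is_derive x 1 (fun s => odd_sine_sum s gamma N)
    (2 * \sum_(0 <= n < N) x ^+ (2 * n) * sin ((2 * n + 1)%:R * gamma)).
Proof.
elim: N => [|N ih].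
  rewrite big_geq// mulr0 /odd_sine_sum.
  under eq_fun do rewrite big_geq//.
  exact: is_derive_cst.
rewrite big_nat_recr//= mulrDr.
have -> : (fun s => odd_sine_sum s gamma N.+1) =
    (fun s => odd_sine_sum s gamma N + (2 / (2 * N + 1)%:R *
      sin ((2 * N + 1)%:R * gamma)) * s ^+ (2 * N + 1)).
  apply/funext => s; rewrite /odd_sine_sum big_nat_recr//=; congr (_ + _); ring.
apply: is_derive1_add => //.
apply: (is_derive_eq (is_derive1_mull _ (is_derive1_exprn _ _))).
rewrite (_ : (2 * N + 1).-1 = 2 * N)%N; last by rewrite addn1.
move: (odd_neq0 N); set c := (2 * N + 1)%:R => c0.
by field.
Qed.

Lemma is_derive_half_arc gamma x : sin gamma != 0 ->
  is_derive x 1 (fun s => half_arc s gamma)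
    (sin gamma / (sin gamma ^+ 2 + (cos gamma + x) ^+ 2) +
     sin gamma / (sin gamma ^+ 2 + (cos gamma - x) ^+ 2)).
Proof.
move=> k0.
have h (e : R) : is_derive x 1
     (fun s => atan (cos gamma / sin gamma + e / sin gamma * s))
   (e * (sin gamma / (sin gamma ^+ 2 + (cos gamma + e * x) ^+ 2))).
  have d1 := is_derive1_affine (cos gamma / sin gamma) (e / sin gamma) x.
  apply: (is_derive_eq (is_derive1_comp _ d1)).
  have D0 : 0 < sin gamma ^+ 2 + (cos gamma + e * x) ^+ 2.
    by rewrite ltr_pwDl ?sqr_ge0// lt_neqAle sqr_ge0 eq_sym sqrf_eq0 k0.
  have D1 : 0 < 1 + (cos gamma / sin gamma + e / sin gamma * x) ^+ 2.
    by rewrite ltr_pwDl ?sqr_ge0.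
  have -> : 1 + (cos gamma / sin gamma + e / sin gamma * x) ^+ 2 =
    (sin gamma ^+ 2 + (cos gamma + e * x) ^+ 2) / sin gamma ^+ 2 by field.
  by field; rewrite k0 gt_eqF.
have -> : (fun s => half_arc s gamma) = (fun s =>
    atan (cos gamma / sin gamma + 1 / sin gamma * s) -
    atan (cos gamma / sin gamma + -1 / sin gamma * s)).
  by apply/funext => s; rewrite /half_arc; congr (atan _ - atan _); field.
apply: (is_derive_eq (is_derive1_sub (h 1) (h (-1)))).
by rewrite !mul1r !mulN1r opprK.
Qed.

(** Half the derivative in [x] of [odd_sine_sum x gamma N], in closed form: it is
    the imaginary part of a finite geometric sum of ratio [(x e^(i gamma)) ^ 2],
    and the factor on the left is the squared modulus of one minus the ratio. *)
Lemma geometric_odd_sine gamma (N : nat) x :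
  (\sum_(0 <= n < N) x ^+ (2 * n) * sin ((2 * n + 1)%:R * gamma)) *
   ((sin gamma ^+ 2 + (cos gamma + x) ^+ 2) * (sin gamma ^+ 2 + (cos gamma - x) ^+ 2)) =
  (1 + x ^+ 2) * sin gamma - x ^+ (2 * N) * sin ((2 * N + 1)%:R * gamma)
  + x ^+ (2 * N) * x ^+ 2 * sin ((2 * N + 1)%:R * gamma - 2 * gamma).
Proof.
have sc := cos2Dsin2 gamma.
set D := (X in _ * X = _).
have c2 : cos (2 * gamma) = cos gamma ^+ 2 - sin gamma ^+ 2.
  by rewrite (_ : 2 * gamma = gamma + gamma) ?cosD; [ring|lra].
have DE : D = 1 + x ^+ 4 - 2 * x ^+ 2 * cos (2 * gamma).
  have e1 : sin gamma ^+ 2 = 1 - cos gamma ^+ 2 by rewrite -sc; ring.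
  by rewrite /D c2 e1; ring.
elim: N => [|N ih].
  rewrite big_geq// mul0r muln0 add0n expr0 !mul1r.
  have -> : gamma - 2 * gamma = - gamma by ring.
  by rewrite sinN; ring.
rewrite big_nat_recr//= mulrDl ih.
have -> : (2 * N.+1 + 1)%:R * gamma = (2 * N + 1)%:R * gamma + 2 * gamma.
  by rewrite -mulrDl -natrD mulnS -addnA addnC.
set t := (2 * N + 1)%:R * gamma.
rewrite addrK mulnS exprD sinB sinD DE.
set y := x ^+ (2 * N); ring.
Qed.

(** The bound is uniform in [gamma], which is what makes term-by-term integration
    possible. *)
Lemma half_arc_approx s gamma (N : nat) : 0 <= s < 1 -> sin gamma != 0 ->
  `|half_arc s gamma - odd_sine_sum s gamma N| <= 4 / (1 - s ^+ 2) ^+ 2 * s ^+ (2 * N).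
Proof.
move=> /andP[s0 s1] k0.
have sc := cos2Dsin2 gamma.
have dE x := is_derive1_sub (is_derive_half_arc x k0) (is_derive_odd_sine_sum gamma N x).
have [z zs] := MVT_segment s0 (fun x _ => dE x)
   (continuous_subspaceT (is_derive1_continuous dE)).
have E0 : half_arc 0 gamma - odd_sine_sum 0 gamma N = 0.
  rewrite /half_arc addr0 subr0 subrr sub0r /odd_sine_sum big1_seq ?oppr0// => i _.
  by rewrite addn1 expr0n /= mulr0 !mul0r.
rewrite E0 !subr0 => ->.
move: zs; rewrite in_itv/= => /andP[z0 zs].
have P1 : 0 < sin gamma ^+ 2 + (cos gamma + z) ^+ 2.
  by rewrite ltr_pwDl ?sqr_ge0// lt_neqAle sqr_ge0 eq_sym sqrf_eq0 k0.
have P2 : 0 < sin gamma ^+ 2 + (cos gamma - z) ^+ 2.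
  by rewrite ltr_pwDl ?sqr_ge0// lt_neqAle sqr_ge0 eq_sym sqrf_eq0 k0.
have z1 : z < 1 by exact: le_lt_trans s1.
have geo := geometric_odd_sine gamma N z.
move: geo; set S := \sum_(_ <= _ < _) _; set th := (2 * N + 1)%:R * gamma => geo.
set D1 := sin gamma ^+ 2 + (cos gamma + z) ^+ 2 in P1 geo *.
set D2 := sin gamma ^+ 2 + (cos gamma - z) ^+ 2 in P2 geo *.
have P : 0 < D1 * D2 by rewrite mulr_gt0.
have -> : sin gamma / D1 + sin gamma / D2 - 2 * S =
   2 * z ^+ (2 * N) * (sin th - z ^+ 2 * sin (th - 2 * gamma)) / (D1 * D2).
  have D12 : D1 + D2 = 2 * (1 + z ^+ 2) by rewrite /D1 /D2; lra.
  have -> : S = ((1 + z ^+ 2) * sin gamma - z ^+ (2 * N) * sin th +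
      z ^+ (2 * N) * z ^+ 2 * sin (th - 2 * gamma)) / (D1 * D2).
    by rewrite -geo mulfK// gt_eqF.
  have -> : sin gamma / D1 + sin gamma / D2 = sin gamma * (D1 + D2) / (D1 * D2).
    by field; rewrite !gt_eqF.
  by rewrite D12; field; rewrite !gt_eqF.
set y := z ^+ (2 * N); set w := sin th - z ^+ 2 * sin (th - 2 * gamma).
have y0 : 0 <= y by rewrite exprn_ge0.
have ys : y <= s ^+ (2 * N) by rewrite lerXn2r// nnegrE.
have z2 : 0 <= z ^+ 2 <= 1 by rewrite sqr_ge0 expr_le1// ltW.
have zs2 : z ^+ 2 <= s ^+ 2 by rewrite lerXn2r// nnegrE.
have s21 : s ^+ 2 < 1 by rewrite expr_lt1.
have w2 : `|w| <= 2.
  have h1 := sin_le1 th; have h2 := sin_geN1 th.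
  have h3 := sin_le1 (th - 2 * gamma); have h4 := sin_geN1 (th - 2 * gamma).
  rewrite (le_trans (ler_normB _ _))// -[leRHS]/(1 + 1) lerD//.
    by rewrite ler_norml h1 h2.
  rewrite normrM ger0_norm ?sqr_ge0// mulr_ile1 ?sqr_ge0//; first by case/andP: z2.
  by rewrite ler_norml h3 h4.
have Q0 : 0 < (1 - s ^+ 2) ^+ 2 by rewrite exprn_gt0// subr_gt0.
have PQ : (1 - s ^+ 2) ^+ 2 <= D1 * D2.
  have -> : D1 * D2 = (1 - z ^+ 2) ^+ 2 + 4 * z ^+ 2 * sin gamma ^+ 2.
    have e1 : cos gamma ^+ 2 = 1 - sin gamma ^+ 2 by rewrite -sc; ring.
    have e2 : D1 = 1 + z ^+ 2 + 2 * z * cos gamma by rewrite /D1; lra.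
    have e3 : D2 = 1 + z ^+ 2 - 2 * z * cos gamma by rewrite /D2; lra.
    rewrite e2 e3.
    transitivity ((1 + z ^+ 2) ^+ 2 - 4 * z ^+ 2 * cos gamma ^+ 2); first by ring.
    by rewrite e1; ring.
  rewrite (@le_trans _ _ ((1 - z ^+ 2) ^+ 2))//.
    by rewrite lerXn2r ?nnegrE//; move/andP: z2 => [? ?]; lra.
  by rewrite lerDl mulr_ge0 ?sqr_ge0// mulr_ge0 ?sqr_ge0.
rewrite !normrM normfV (gtr0_norm P) (ger0_norm s0) (ger0_norm y0) ger0_norm//.
rewrite (@le_trans _ _ (2 * y * `|w| / (D1 * D2)))//.
  have h : 0 <= 2 * y * `|w| / (D1 * D2) by rewrite !mulr_ge0// invr_ge0 ltW.
  by have := ler_piMr h (ltW s1).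
rewrite (@le_trans _ _ (4 * y / (D1 * D2)))//.
  rewrite ler_pM2r ?invr_gt0//; have := ler_wpM2l y0 w2; lra.
rewrite [leRHS]mulrAC; apply: ler_pM => //.
- by rewrite mulr_ge0.
- by rewrite invr_ge0 ltW.
- by rewrite ler_pM2l.
- by rewrite lef_pV2.
Qed.
End half_arc_series.

(** * Integration over the angle *)

Section integral_squeeze.
Context {R : realType}.
Notation mu := (@lebesgue_measure R).
Notation U := (uniform_prob (@lt0_2pi R)).

Lemma integral_itv_antiderivative (g G : R -> R) (a b : R) : a < b ->
  continuous g -> (forall x : R, is_derive x 1 G (g x)) ->
  (\int[mu]_(x in `[a, b]) (g x)%:E = (G b - G a)%:E)%E.
Proof.
move=> ab cg dG; rewrite EFinB; apply: continuous_FTC2 => //.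
- exact: continuous_subspaceT.
- have cG : continuous G by exact: is_derive1_continuous dG.
  split; first by move=> x _; have [] := dG x.
  + by apply: cvg_at_right_filter; exact: cG.
  + by apply: cvg_at_left_filter; exact: cG.
- by move=> x _; rewrite derive1E; have [] := dG x.
Qed.

(** If [f] is uniformly within [e] of a continuous [g] on [`]a, b[], its integral
    is within [e * (b - a)] of that of [g]. *)
Lemma integral_itv_squeeze (f : R -> \bar R) (phi g G : R -> R) (a b e : R) :
  a < b -> measurable_fun setT f -> (forall x, 0 <= f x)%E ->
  (forall x, x \in `]a, b[ -> f x = (phi x)%:E /\ `|phi x - g x| <= e) ->
  continuous g -> (forall x : R, is_derive x 1 G (g x)) ->
  exists k : R, (\int[mu]_(x in `[a, b]) f x = k%:E)%E /\
    `|k - (G b - G a)| <= e * (b - a).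
Proof.
move=> ab mf f0 fE cg dG.
have mfS (D : set R) : measurable_fun D f by exact: measurable_funS mf.
have shifted (c : R) : (\int[mu]_(x in `]a, b[) (g x + c)%:E =
    (G b - G a + c * (b - a))%:E)%E.
  have cgc : continuous (fun x => g x + c).
    by move=> x; apply: continuousD; [exact: cg|exact: cvg_cst].
  have dGc (x : R) : is_derive x 1 (fun y => G y + c * y) (g x + c).
    apply: (is_derive_eq (is_derive1_add (dG x)
      (is_derive1_mull c (is_derive_id x 1)))).
    by rewrite mulr1.
  rewrite -(@integral_itv_bndoo _ a b _ true false); last first.
    by apply/measurable_EFinP/measurable_funTS; exact: continuous_measurable_fun.
  rewrite (integral_itv_antiderivative ab cgc dGc).
  by congr EFin; ring.
have intg (c : R) : mu.-integrable `]a, b[ (EFin \o (fun x => g x + c)).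
  have cgc : continuous (fun x => g x + c).
    by move=> x; apply: continuousD; [exact: cg|exact: cvg_cst].
  apply: (@integrableS _ _ _ mu `[a, b]) => //.
    by apply: subset_itv; rewrite bnd_simp.
  apply: continuous_compact_integrable; first exact: segment_compact.
  exact: continuous_subspaceT.
have fle x : x \in `]a, b[%classic -> (f x <= (g x + e)%:E)%E.
  rewrite inE => /fE[-> h]; rewrite lee_fin; move: h; rewrite ler_norml; lra.
have gle x : x \in `]a, b[%classic -> ((g x + (- e))%:E <= f x)%E.
  rewrite inE => /fE[-> h]; rewrite lee_fin; move: h; rewrite ler_norml; lra.
have intf : mu.-integrable `]a, b[ f.
  apply: le_integrable (intg e) => // [|x xab]; first exact: mfS.
  rewrite gee0_abs//=.
  rewrite (le_trans (fle x _)) ?inE// lee_fin; exact: ler_norm.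
rewrite integral_itv_bndoo//.
have up : (\int[mu]_(x in `]a, b[) f x <= (G b - G a + e * (b - a))%:E)%E.
  by rewrite -shifted; apply: le_integral => //; exact: intg.
have lo : ((G b - G a + - e * (b - a))%:E <= \int[mu]_(x in `]a, b[) f x)%E.
  by rewrite -shifted; apply: le_integral => //; exact: intg.
exists (fine (\int[mu]_(x in `]a, b[) f x)).
have fin : (\int[mu]_(x in `]a, b[) f x)%E \is a fin_num.
  by rewrite fin_numE; apply/andP; split; apply/eqP => h; move: up lo; rewrite h.
split; first by rewrite fineK.
move: up lo; rewrite -(fineK fin) !lee_fin ler_norml; lra.
Qed.

End integral_squeeze.

Section odd_sums.
Context {R : realType}.
Implicit Types s gamma : R.

(** The antiderivative of [odd_sine_sum s] in the angle. *)
Definition odd_cosine_sum s gamma (N : nat) : R :=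
  - \sum_(0 <= n < N) 2 * s ^+ (2 * n + 1) / (2 * n + 1)%:R ^+ 2 *
    cos ((2 * n + 1)%:R * gamma).

Lemma is_derive_odd_cosine_sum s (N : nat) gamma :
  is_derive gamma 1 (fun x => odd_cosine_sum s x N) (odd_sine_sum s gamma N).
Proof.
elim: N => [|N ih].
  rewrite /odd_sine_sum /odd_cosine_sum.
  under eq_fun do rewrite big_geq//.
  by rewrite big_geq//; exact: is_derive_cst.
have -> : (fun x => odd_cosine_sum s x N.+1) =
    (fun x => odd_cosine_sum s x N + (- (2 * s ^+ (2 * N + 1) / (2 * N + 1)%:R ^+ 2)) *
      cos ((2 * N + 1)%:R * x)).
  by apply/funext => x; rewrite /odd_cosine_sum big_nat_recr//= opprD mulNr.
rewrite /odd_sine_sum big_nat_recr//=.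
apply: is_derive1_add => //.
set c : R := (2 * N + 1)%:R; have c0 : c != 0 by exact: odd_neq0.
have dl := is_derive1_mull c (is_derive_id gamma 1).
apply: (is_derive_eq (is_derive1_mull _ (is_derive1_comp (is_derive_cos _) dl))).
by field.
Qed.

Lemma continuous_odd_sine_sum s (N : nat) : continuous (fun x => odd_sine_sum s x N).
Proof.
elim: N => [|N ih].
  have -> : (fun x => odd_sine_sum s x 0) = cst 0.
    by apply/funext => x; rewrite /odd_sine_sum big_geq.
  by move=> x; exact: cvg_cst.
have -> : (fun x => odd_sine_sum s x N.+1) = (fun x => odd_sine_sum s x N +
    2 * s ^+ (2 * N + 1) / (2 * N + 1)%:R * sin ((2 * N + 1)%:R * x)).
  by apply/funext => x; rewrite /odd_sine_sum big_nat_recr.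
move=> x; apply: cvgD; first exact: ih.
apply: cvgM; first exact: cvg_cst.
apply: (cvg_comp (fun x => (2 * N + 1)%:R * x) sin); last exact: continuous_sin.
by apply: cvgM; [exact: cvg_cst|exact: cvg_id].
Qed.

(** The partial sums of the series defining [legendre_chi2]. *)
Definition chi2_sum s (N : nat) : R :=
  series (fun n : nat => s ^+ (2 * n + 1) / (2 * n + 1)%:R ^+ 2) N.

Lemma cos_odd_pi (n : nat) : cos ((2 * n + 1)%:R * pi) = -1 :> R.
Proof.
elim: n => [|n ih]; first by rewrite mul1r cospi.
have -> : (2 * n.+1 + 1)%:R * pi = (2 * n + 1)%:R * pi + pi *+ 2 :> R.
  by rewrite -(mulr_natl pi 2) -mulrDl -natrD mulnS -addnA addnC.
by rewrite cosD2pi.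
Qed.

Lemma cos_odd_2pi (n : nat) : cos ((2 * n + 1)%:R * (2 * pi)) = 1 :> R.
Proof.
have -> : (2 * n + 1)%:R * (2 * pi) = 0 + pi *+ 2 *+ (2 * n + 1) :> R.
  by rewrite add0r (mulr_natl _ (2 * n + 1)) (mulr_natl pi 2).
by rewrite (periodicn (@cosD2pi R)) cos0.
Qed.

Lemma odd_cosine_sum0 s N : odd_cosine_sum s 0 N = - (2 * chi2_sum s N).
Proof.
rewrite /odd_cosine_sum /chi2_sum /series /= big_distrr/=; congr (- _).
by apply: eq_bigr => n _; rewrite mulr0 cos0 mulr1 mulrA.
Qed.

Lemma odd_cosine_sumpi s N : odd_cosine_sum s pi N = 2 * chi2_sum s N.
Proof.
rewrite /odd_cosine_sum /chi2_sum /series /= big_distrr/= -sumrN.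
by apply: eq_bigr => n _; rewrite cos_odd_pi mulrN1 opprK mulrA.
Qed.

Lemma odd_cosine_sum2pi s N : odd_cosine_sum s (2 * pi) N = - (2 * chi2_sum s N).
Proof.
rewrite /odd_cosine_sum /chi2_sum /series /= big_distrr/=; congr (- _).
by apply: eq_bigr => n _; rewrite cos_odd_2pi mulr1 mulrA.
Qed.

End odd_sums.

Section conclusion.
Context {R : realType}.
Notation mu := (@lebesgue_measure R).
Notation U := (uniform_prob (@lt0_2pi R)).

Lemma sin_lt0_pi2pi (x : R) : x \in `]pi, 2 * pi[ -> sin x < 0.
Proof.
rewrite in_itv/= => /andP[h1 h2].
rewrite -[x](subrK pi) sinDpi oppr_lt0 sin_gt0_pi//.
by apply/andP; split; lra.
Qed.

Lemma half_arc_ge0 (s x : R) : 0 < s -> 0 < sin x -> 0 <= half_arc s x.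
Proof.
by move=> s0 sx; rewrite subr_ge0 le_atan// ler_pM2r ?invr_gt0//; lra.
Qed.

Lemma half_arc_le0 (s x : R) : 0 < s -> sin x < 0 -> half_arc s x <= 0.
Proof.
by move=> s0 sx; rewrite subr_le0 le_atan// ler_nM2r ?invr_lt0//; lra.
Qed.

Lemma integral_obtuse_arc_approx (rho : R) (N : nat) : 0 < rho -> 2 <= rho ^+ 2 ->
  let s := 1 / rho in
  exists k : R, (\int[U]_gamma U (obtuse_arc rho gamma) = k%:E)%E /\
   `|k - (1 - 4 / pi ^+ 2 * chi2_sum s N)| <= 4 / (1 - s ^+ 2) ^+ 2 * s ^+ (2 * N) / pi.
Proof.
move=> rho0 rho2 s; have pi0 := pi_gt0 R.
have s0 : 0 < s by rewrite divr_gt0.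
have s1 : s < 1.
  rewrite /s div1r invf_lt1//; nra.
have s01 : 0 <= s < 1 by rewrite s1 ltW.
set e := 4 / (1 - s ^+ 2) ^+ 2 * s ^+ (2 * N).
pose f gamma := U (obtuse_arc rho gamma).
have mf : measurable_fun setT f by exact: measurable_fun_obtuse_arc.
have f0 x : (0 <= f x)%E by exact: measure_ge0.
(* One half of the circle, on which [half_arc] has the constant sign [sgn]. *)
have half (a b sgn : R) : a < b -> sgn ^+ 2 = 1 ->
    (forall x, x \in `]a, b[ -> sin x != 0 /\ `|half_arc s x| = sgn * half_arc s x) ->
    exists k : R, (\int[mu]_(x in `[a, b]) f x = k%:E)%E /\
      `|k - (b - a - sgn / pi * (odd_cosine_sum s b N - odd_cosine_sum s a N))|
        <= e / pi * (b - a).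
  move=> ab sgn2 hab.
  pose g (x : R) : R := 1 - sgn / pi * odd_sine_sum s x N.
  pose G (x : R) : R := x - sgn / pi * odd_cosine_sum s x N.
  have cg : continuous g.
    rewrite /g => x; apply: cvgB; first exact: cvg_cst.
    by apply: cvgM; [exact: cvg_cst|exact: continuous_odd_sine_sum].
  have dG (x : R) : is_derive x 1 G (g x).
    exact: (is_derive1_sub (is_derive_id x 1)
      (is_derive1_mull _ (is_derive_odd_cosine_sum s N x))).
  have [|k [kE ke]] := @integral_itv_squeeze _ f (fun x => 1 - `|half_arc s x| / pi) g G
     a b (e / pi) ab mf f0 _ cg dG; last first.
    exists k; split => //; move: ke; rewrite /G; congr (`|_| <= _); ring.
  move=> x xab; have [sx ->] := hab x xab; split.
    by rewrite /f uniform_obtuse_arc// (hab x xab).2.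
  rewrite /g.
  have -> : 1 - sgn * half_arc s x / pi - (1 - sgn / pi * odd_sine_sum s x N) =
    - (sgn * (half_arc s x - odd_sine_sum s x N) / pi) by ring.
  rewrite normrN normrM normfV (gtr0_norm pi0) ler_pM2r ?invr_gt0// normrM.
  have -> : `|sgn| = 1.
    by move/eqP: sgn2; rewrite sqrf_eq1 => /orP[] /eqP ->; rewrite ?normrN normr1.
  by rewrite mul1r half_arc_approx.
have [|||k1 [k1E k1e]] := half 0 pi 1 => //.
- by rewrite expr1n.
- move=> x xab; have sx : 0 < sin x by apply: sin_gt0_pi.
  by rewrite gt_eqF// mul1r ger0_norm ?half_arc_ge0.
have [|||k2 [k2E k2e]] := half pi (2 * pi) (-1).
- lra.
- by rewrite sqrrN expr1n.
- move=> x xab; have sx := sin_lt0_pi2pi xab.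
  by rewrite lt_eqF// mulN1r ler0_norm ?half_arc_le0.
exists ((2 * pi)^-1 * (k1 + k2)); split.
  rewrite integral_uniform// subr0 (@ge0_integral_itvcc_split _ _ _ pi)//; last first.
    by apply/andP; split; lra.
  by rewrite k1E k2E -EFinD -EFinM.
move: k1e k2e; rewrite odd_cosine_sum0 odd_cosine_sumpi odd_cosine_sum2pi.
set c := chi2_sum s N => k1e k2e.
have -> : (2 * pi)^-1 * (k1 + k2) - (1 - 4 / pi ^+ 2 * c) = (2 * pi)^-1 *
  ((k1 - (pi - 0 - 1 / pi * (2 * c - - (2 * c)))) +
   (k2 - (2 * pi - pi - -1 / pi * (- (2 * c) - 2 * c)))).
  by move: (gt_eqF pi0); move: (pi : R) => p p0; field; rewrite p0.
rewrite normrM gtr0_norm ?invr_gt0 ?lt0_2pi//.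
rewrite mulrC ler_pdivrMr ?lt0_2pi//.
rewrite (le_trans (ler_normD _ _))// (le_trans (lerD k1e k2e))//.
by rewrite le_eqVlt; apply/orP; left; apply/eqP; ring.
Qed.

Lemma integral_obtuse_arc (rho : R) : 0 < rho -> 2 <= rho ^+ 2 ->
  (\int[U]_gamma U (obtuse_arc rho gamma) =
   (1 - 4 / pi ^+ 2 * legendre_chi2 (1 / rho))%:E)%E.
Proof.
move=> rho0 rho2; have pi0 := pi_gt0 R.
set s := 1 / rho.
have s0 : 0 < s by rewrite divr_gt0.
have s1 : s < 1 by rewrite /s div1r invf_lt1//; nra.
(* The integral does not depend on [N], so its approximations converge to it. *)
have [k [kE _]] := integral_obtuse_arc_approx 0 rho0 rho2.
rewrite kE; congr EFin.
set C := 4 / (1 - s ^+ 2) ^+ 2.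
have bound N : `|k - (1 - 4 / pi ^+ 2 * chi2_sum s N)| <= C / pi * s ^+ N.
  have [k' [k'E]] := integral_obtuse_arc_approx N rho0 rho2.
  move: k'E; rewrite kE => -[<-] h; apply: (le_trans h).
  rewrite -/s -/C mulrAC ler_wpM2l//.
    by rewrite divr_ge0 ?ltW// divr_gt0// exprn_gt0// subr_gt0 expr_lt1// ltW.
  by rewrite ler_wiXn2l ?ltW// leq_pmull.
have cvg0 : (C / pi * s ^+ N) @[N --> \oo] --> (0 : R).
  rewrite -[X in _ --> X](mulr0 (C / pi)); apply: cvgMr.
  by apply: cvg_expr; rewrite gtr0_norm.
have cvgk : (1 - 4 / pi ^+ 2 * chi2_sum s N) @[N --> \oo] --> k.
  apply/cvgrPdist_le => eps eps0.
  move/cvgrPdist_le: cvg0 => /(_ _ eps0) [M _ hM]; exists M => // N MN.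
  apply: (le_trans (bound N)); have := hM N MN.
  by rewrite sub0r normrN; apply: le_trans; exact: ler_norm.
have cvgc : chi2_sum s N @[N --> \oo] --> (1 - k) * (pi ^+ 2 / 4).
  have -> : (fun N => chi2_sum s N) =
      (fun N => (1 - (1 - 4 / pi ^+ 2 * chi2_sum s N)) * (pi ^+ 2 / 4)).
    apply/funext => N; move: (gt_eqF pi0); move: (pi : R) (chi2_sum s N) => p c p0.
    by field; rewrite p0.
  by apply: cvgMl; apply: cvgB => //; exact: cvg_cst.
have -> : legendre_chi2 s = (1 - k) * (pi ^+ 2 / 4) by exact/cvg_lim.
move: (gt_eqF pi0); move: (pi : R) => p p0.
by field; rewrite p0.
Qed.
End conclusion.

(** * Probability of an obtuse triangle *)

Lemma mutually_independent3 {R : realType} d (T : measurableType d)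
    (P : probability T R) d' (T' : measurableType d')
    (X : 'I_3 -> {RV P >-> T'}) (A B C : set T') : mutually_independent X ->
  measurable A -> measurable B -> measurable C ->
  P (X 0 @^-1` A `&` X 1 @^-1` B `&` X 2 @^-1` C) =
  (P (X 0%R @^-1` A) * P (X 1%R @^-1` B) * P (X 2%R @^-1` C))%E.
Proof.
move=> indep mA mB mC.
pose D (i : 'I_3) := nth A [:: A; B; C] i.
have mD i : measurable (D i) by case: i => -[|[|[|]]].
have := indep [set: 'I_3]%SET D mD.
rewrite (eq_bigl xpredT) => [|i]; last exact: finset.in_setT.
rewrite !big_ord_recl big_ord0 mule1 muleA.
have -> : lift ord0 (ord0 : 'I_2) = 1 :> 'I_3 by exact/val_inj.
have -> : lift ord0 (lift ord0 (ord0 : 'I_1)) = 2 :> 'I_3 by exact/val_inj.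
have -> : ord0 = 0 :> 'I_3 by exact/val_inj.
move=> <-; congr (P _); apply/seteqP; split=> t /=.
  move=> [[tA tB] tC] i _; rewrite /D.
  case: i => -[|[|[|//]]] h.
  - by rewrite (_ : Ordinal h = 0) //; exact/val_inj.
  - by rewrite (_ : Ordinal h = 1) //; exact/val_inj.
  - by rewrite (_ : Ordinal h = 2) //; exact/val_inj.
move=> H; split; first split.
- exact: (H 0 (finset.in_setT _)).
- exact: (H 1 (finset.in_setT _)).
- exact: (H 2 (finset.in_setT _)).
Qed.

Theorem corollary5p4 (R : realType) (d : measure_display)
    (T : measurableType d) (P : probability T R)
    (rho : R) (hrho : Num.sqrt 2 <= rho)
    (r : 'I_3 -> R) (hr0 : r 0 = 1) (hr1 : r 1 = 1) (hr2 : r 2 = rho)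
    (X : 'I_3 -> {RV P >-> (R * R)%type})
    (hindep : mutually_independent X)
    (hunif : forall k : 'I_3, uniform_on_circle (r k) (X k)) :
  P [set t | obtuse (X 0 t) (X 1 t) (X 2 t)] =
  (1 - 4 / pi ^+ 2 * legendre_chi2 (1 / rho))%:E.
Proof.
have rho0 : 0 < rho by rewrite (lt_le_trans _ hrho)// sqrtr_gt0.
have rho2 : 2 <= rho ^+ 2.
  by rewrite -[leLHS](@sqr_sqrtr _ 2)// lerXn2r// ?nnegrE ?sqrtr_ge0// ltW.
rewrite (@probability_obtuse _ _ _ _ rho)//.
- exact: integral_obtuse_arc.
- by have := hunif 0; rewrite hr0.
- by have := hunif 1; rewrite hr1.
- by have := hunif 2; rewrite hr2.
- by move=> A B C; exact: mutually_independent3.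
Qed.
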